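(* Let $b$ be a prime and let $d\ge1$, $m\ge1$, $0\le t\le m$ be integers. Let $\mathcal{P}\subseteq\mathbb{U}^d_b$ be a subgroup (under addition) of cardinality $b^m$. Then $\mathcal{P}$ is a $(t,m,d)$-net in $\mathbb{U}^d_b$ if and only if $\mathrm{minNRT}(\mathcal{P})\ge m-t+1$.
   Context: $K=\mathbb{F}_b((x^{-1}))$ is the field of formal Laurent series $\sum_{i=w}^\infty c_ix^{-i}$ over $\mathbb{F}_b$. For $f=\sum_{i\ge w}c_ix^{-i}$ with $c_w\neq0$, $\deg(f)=-w$; $\deg(0)=-\infty$. $\mathbb{U}^d_b=\{(g_1,\dots,g_d)\in K^d:\deg(g_j)<0\ \forall j\}$. $(t,m,d)$-net in $\mathbb{U}^d_b$: for integers $m\ge1$, $0\le t\le m$, $d\ge1$, a set $\mathcal{P}\subset\mathbb{U}_b^d$ of $b^m$ points is a $(t,m,d)$-net in $\mathbb{U}^d_b$ if for all nonnegative integers $l_1,\dots,l_d$ with $l_1+\dots+l_d=m-t$ and all $h_j\in\{c_1x^{-1}+\dots+c_{l_j}x^{-l_j}:c_i\in\mathbb{F}_b\}$ ($1\le j\le d$), the set $\{\boldsymbol g\in\mathbb{U}_b^d:\deg(g_j-h_j)<-l_j\ \text{for all }1\le j\le d\}$ contains exactly $b^t$ points of $\mathcal{P}$. $\mathrm{res}:K\to\mathbb{F}_b$ maps $\sum_ic_ix^{-i}$ to $c_1$. For a subgroup $\mathcal{P}\subseteq\mathbb{U}^d_b$ the orthogonal space (identified with a subset of $\mathbb{F}_b[x]^d$)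 is $\mathcal{D}(\mathcal{P})=\{\boldsymbol g\in\mathbb{F}_b[x]^d:\mathrm{res}(\sum_{j}g_jh_j)=0\text{ for all }\boldsymbol h\in\mathcal{P}\}$. NRT weight: for $g\in\mathbb{F}_b[x]$, $\mu(g)=1+\deg g$ if $g\ne0$ and $\mu(0)=0$; for $\boldsymbol g\in\mathbb{F}_b[x]^d$, $\mu(\boldsymbol g)=\sum_{j=1}^d\mu(g_j)$. $\mathrm{minNRT}(\mathcal{P})=\inf\{\mu(\boldsymbol g):\boldsymbol g\in\mathcal{D}(\mathcal{P})\setminus\{\boldsymbol0\}\}$. *)

(* Defs.v *)
From HB Require Import structures.
From mathcomp Require Import all_boot all_order all_algebra.
From mathcomp Require Import boolp classical_sets functions cardinality fsbigop.
From mathcomp Require Import constructive_ereal.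
From mathcomp Require Import zify.

Set Implicit Arguments.
Unset Strict Implicit.
Unset Printing Implicit Defensive.

Import Order.TTheory GRing.Theory Num.Theory.

Local Open Scope classical_set_scope.
Local Open Scope card_scope.
Local Open Scope ring_scope.

Section LaurentSeries.
Variable F : fieldType.
Implicit Types (c : int -> F) (w i j : int).

Definition vanishes_below w c := forall i, i < w -> c i = 0.

(* [c] encodes the series $\sum_i c_i x^{-i}$: the coefficient of index [i] is
   that of $x^{-i}$, so only finitely many negative indices may occur. *)
Definition laurent_coefs : {pred int -> F} :=
  fun c => `[< exists w, vanishes_below w c >].

Record laurent := Laurent { lcoef :> int -> F; _ : lcoef \in laurent_coefs }.

HB.instance Definition _ := [isSub for lcoef].
HB.instance Definition _ := [Choice of laurent by <:].

Implicit Types f g h : laurent.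

Lemma laurentP f g : lcoef f =1 lcoef g -> f = g.
Proof. by move=> fg; apply/val_inj/funext. Qed.

Lemma laurent_lb f : exists w, vanishes_below w f.
Proof. by case: f => c /= /asboolP. Qed.

Fact laurent_coefs_zmod_closed : zmod_closed laurent_coefs.
Proof.
split; first by apply/asboolP; exists 0.
move=> c c' /asboolP[w cw] /asboolP[w' cw']; apply/asboolP.
exists (Num.min w w') => i; rewrite lt_min => /andP[iw iw'].
by rewrite -[LHS]/(c i - c' i) cw // cw' // subr0.
Qed.

HB.instance Definition _ :=
  GRing.isZmodClosed.Build (int -> F) laurent_coefs laurent_coefs_zmod_closed.
HB.instance Definition _ := [SubChoice_isSubZmodule of laurent by <:].

Lemma lcoef0 i : (0 : laurent) i = 0. Proof. by []. Qed.

Lemma lcoefD f g i : (f + g) i = f i + g i. Proof. by []. Qed.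

Lemma lcoefN f i : (- f) i = - f i. Proof. by []. Qed.

Lemma lcoefB f g i : (f - g) i = f i - g i. Proof. by []. Qed.

Fact lmonom_subproof (a : F) i :
  (fun j => if j == i then a else 0) \in laurent_coefs.
Proof. by apply/asboolP; exists i => j; rewrite lt_neqAle => /andP[/negPf->]. Qed.

(* The monomial $a x^{-i}$. *)
Definition lmonom (a : F) i : laurent := Laurent (lmonom_subproof a i).

Definition lmul_coef c c' j : F := \sum_(i \in [set: int]) (c i * c' (j - i)).

Lemma lmul_coef_lt c c' w w' j :
  vanishes_below w c -> vanishes_below w' c' -> j < w + w' ->
  lmul_coef c c' j = 0.
Proof.
move=> cw cw' ltj; apply: fsbig1 => i _.
have [iw|wi] := ltP i w; first by rewrite cw // mul0r.
by rewrite cw' ?mulr0//; lia.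
Qed.

Fact lmul_subproof f g : lmul_coef f g \in laurent_coefs.
Proof.
have [w fw] := laurent_lb f; have [w' gw'] := laurent_lb g.
by apply/asboolP; exists (w + w') => j; apply: lmul_coef_lt.
Qed.

Definition lmul f g : laurent := Laurent (lmul_subproof f g).

Lemma lmul_lb f g w w' : vanishes_below w f -> vanishes_below w' g ->
  vanishes_below (w + w') (lmul f g).
Proof. by move=> fw gw' j; apply: lmul_coef_lt. Qed.

Lemma lmul_coefE f g w w' (n : nat) :
  vanishes_below w f -> vanishes_below w' g ->
  lmul f g (w + w' + n%:Z) =
  \sum_(k < n.+1) f (w + k%:Z) * g (w' + (n - k)%N%:Z).
Proof.
move=> fw gw; rewrite /= /lmul_coef.
pose G i := f i * g (w + w' + n%:Z - i).
rewrite -(@fsbig_widen _ _ _ _ [set w + k%:Z | k in `I_n.+1] _ G) //; last first.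
  move=> i [_ /= iN]; rewrite /G; have [iw|wi] := ltP i w.
    by rewrite fw ?mul0r.
  rewrite gw ?mulr0//; rewrite ltNge; apply/negP => le; apply: iN.
  by exists (`|i - w|)%N; rewrite /=; lia.
rewrite fsbig_image; last by move=> i j _ _ /=; lia.
rewrite -(fsbig_ord _ _ (fun k => G (w + k%:Z))).
apply: eq_bigr => k _; rewrite /G; congr (_ * g _).
by have := ltn_ord k; lia.
Qed.

Definition ltrunc w (N : nat) c : {poly F} := \poly_(k < N) c (w + k%:Z).

Lemma lmul_coefM f g w w' (N n : nat) :
  vanishes_below w f -> vanishes_below w' g -> (n < N)%N ->
  lmul f g (w + w' + n%:Z) = (ltrunc w N f * ltrunc w' N g)`_n.
Proof.
move=> fw gw nN; rewrite (lmul_coefE _ fw gw) coefM; apply: eq_bigr => k _.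
by rewrite !coef_poly !ifT //; have := ltn_ord k; lia.
Qed.

Lemma laurent_shift_eq f g w :
  vanishes_below w f -> vanishes_below w g ->
  (forall n : nat, f (w + n%:Z) = g (w + n%:Z)) -> f = g.
Proof.
move=> fw gw fg; apply: laurentP => j; have [jw|wj] := ltP j w.
  by rewrite fw ?gw.
by have -> : j = w + (`|j - w|%N)%:Z by lia.
Qed.

Fact lmulC : commutative lmul.
Proof.
move=> f g; have [a fa] := laurent_lb f; have [b gb] := laurent_lb g.
apply: (laurent_shift_eq (lmul_lb fa gb)) => [|n].
  by rewrite addrC; exact: lmul_lb.
rewrite (lmul_coefM fa gb (ltnSn n)) addrC [a + b]addrC addrC.
by rewrite (lmul_coefM gb fa (ltnSn n)) mulrC.
Qed.

Fact lmulA : associative lmul.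
Proof.
move=> f g h; have [a fa] := laurent_lb f; have [b gb] := laurent_lb g.
have [c hc] := laurent_lb h.
have gh := lmul_lb gb hc; have fg := lmul_lb fa gb.
apply: (laurent_shift_eq (lmul_lb fa gh)) => [|n].
  by rewrite addrA; exact: lmul_lb.
rewrite (lmul_coefM fa gh (ltnSn n)) addrA (lmul_coefM fg hc (ltnSn n)).
transitivity ((ltrunc a n.+1 f * (ltrunc b n.+1 g * ltrunc c n.+1 h))`_n).
  rewrite !coefM; apply: eq_bigr => k _; congr (_ * _).
  have kn : (n - k < n.+1)%N by lia.
  by rewrite -(lmul_coefM gb hc kn) coef_poly kn.
rewrite mulrA !coefM; apply: eq_bigr => k _; congr (_ * _).
by rewrite -(lmul_coefM fa gb (ltn_ord k)) coef_poly ltn_ord.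
Qed.

Fact lmul1 : left_id (lmonom 1 0) lmul.
Proof.
move=> f; have [a fa] := laurent_lb f.
have l1 : vanishes_below 0 (lmonom 1 0).
  by move=> j; rewrite /= lt_neqAle => /andP[/negPf->].
apply: (@laurent_shift_eq _ _ a) => // [|n].
  by rewrite -[a]add0r; exact: lmul_lb.
rewrite -[a in LHS]add0r (lmul_coefE _ l1 fa) big_ord_recl /= mul1r subn0.
rewrite big1 ?addr0// => k _.
by rewrite mul0r.
Qed.

Fact lmulDl : left_distributive lmul +%R.
Proof.
move=> f g h; have [a fa] := laurent_lb f; have [b gb] := laurent_lb g.
have [c hc] := laurent_lb h; pose w := Num.min a b.
have fw : vanishes_below w f by move=> i iw; apply: fa; lia.
have gw : vanishes_below w g by move=> i iw; apply: gb; lia.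
have fgw : vanishes_below w (f + g).
  by move=> i iw; rewrite lcoefD fw ?gw ?addr0.
apply: (laurent_shift_eq (lmul_lb fgw hc)) => [i iw|n].
  by rewrite lcoefD !(@lmul_lb _ _ w c) ?addr0.
rewrite lcoefD !(@lmul_coefE _ _ w c n)// -big_split /=.
by apply: eq_bigr => k _; rewrite -mulrDl.
Qed.

Fact lmonom1_neq0 : lmonom 1 0 != 0.
Proof.
by apply/eqP => /(congr1 (fun f : laurent => f 0)) /= /eqP; rewrite oner_eq0.
Qed.

HB.instance Definition _ := GRing.Zmodule_isComNzRing.Build laurent
  lmulA lmulC lmul1 lmulDl lmonom1_neq0.

Definition poly_laurent (p : {poly F}) : laurent :=
  \sum_(k < size p) lmonom p`_k (- k%:Z).

Definition ldeg f : \bar int :=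
  if f == 0 then -oo%E
  else (- xget 0 [set w | f w != 0 /\ vanishes_below w f])%:E.

Lemma ldegE f w : f w != 0 -> vanishes_below w f -> ldeg f = (- w)%:E.
Proof.
move=> fw0 fw; rewrite /ldeg ifF; last first.
  by apply/eqP => f0; rewrite f0 lcoef0 eqxx in fw0.
congr (- _)%:E; apply: xget_unique => [//|w' [fw'0 fw']].
case: (ltgtP w' w) => // [/fw|/fw'] e; first by rewrite e eqxx in fw'0.
by rewrite e eqxx in fw0.
Qed.

Definition res f : F := f 1.

End LaurentSeries.

Section Nets.
Variables (b d : nat).
Local Notation K := (laurent 'F_b).

Definition unit_cube : set 'rV[K]_d :=
  [set g : 'rV[K]_d | forall j, (ldeg (g 0%R j) < 0)%E].

Definition digit_series (l : nat) : set K :=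
  [set h : K | exists c : nat -> 'F_b,
    h = \sum_(1 <= i < l.+1) lmonom (c i) i%:Z].

Definition elementary_box (l : 'I_d -> nat) (h : 'rV[K]_d) : set 'rV[K]_d :=
  [set g : 'rV[K]_d | unit_cube g /\
    forall j, (ldeg (g 0 j - h 0 j)%R < (- (l j)%:Z)%R%:E)%E].

Definition is_net (t m : nat) (P : set 'rV[K]_d) : Prop :=
  [/\ P `<=` unit_cube, P #= `I_(b ^ m) &
    forall (l : 'I_d -> nat) (h : 'rV[K]_d),
      (\sum_j l j)%N = (m - t)%N ->
      (forall j, digit_series (l j) (h 0 j)) ->
      (elementary_box l h `&` P) #= `I_(b ^ t)].

Definition is_subgroup (P : set 'rV[K]_d) : Prop := zmod_closed (mem P).

Definition dual_space (P : set 'rV[K]_d) : set 'rV[{poly 'F_b}]_d :=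
  [set g : 'rV[{poly 'F_b}]_d | forall h, P h ->
    res (\sum_j poly_laurent (g 0 j) * h 0 j) = 0].

(* [size p] is [0] for [p = 0] and [1 + deg p] otherwise. *)
Definition NRT_weight (g : 'rV[{poly 'F_b}]_d) : nat :=
  (\sum_j size (g 0%R j))%N.

(* [+oo] is the infimum of the empty set. *)
Definition minNRT (P : set 'rV[K]_d) : \bar int :=
  infimum +oo%E
    [set (NRT_weight g)%:Z%:E | g in dual_space P `\` [set 0]].

End Nets.

(* Main.v *)
(** For [l_1 + ... + l_d = m - t], send [h] to the vector of the first [l_j]
    digits of each [h_j]: this is an additive map from [P] to [F_b^(m - t)],
    whose fibers are the intersections of [P] with the elementary boxes of
    shape [l]. All nonempty fibers have the same size, so the net condition says
    that this map is onto for every [l]. As [b] is prime, its image is a linear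
    subspace, hence it is onto iff no nonzero linear form kills the image; a
    linear form on [F_b^(m - t)] is a vector of polynomials [g] with
    [size g_j <= l_j], and it kills the image iff [g] is in the dual space. *)
From HB Require Import structures.
Require Import Defs.
From mathcomp Require Import all_boot all_order all_algebra.
From mathcomp Require Import boolp classical_sets functions cardinality.
From mathcomp Require Import constructive_ereal.
From mathcomp Require Import finmap fsbigop zify.
Local Open Scope classical_set_scope.
Local Open Scope card_scope.
Local Open Scope ring_scope.
Import Order.TTheory GRing.Theory Num.Theory.
Set Implicit Arguments.
Unset Strict Implicit.

(** * Subgroups: fibers of additive maps and annihilators *)

Section Subgroups.
Variables (V : zmodType) (P : set V).
Hypothesis Pz : zmod_closed (mem P).

Lemma zmod_set0 : P 0.
Proof. by case: Pz => /set_mem. Qed.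

Lemma zmod_setB u v : P u -> P v -> P (u - v).
Proof. by case: Pz => _ PB /mem_set Pu /mem_set Pv; apply/set_mem/PB. Qed.

Lemma zmod_setD u v : P u -> P v -> P (u + v).
Proof.
move=> Pu Pv; rewrite -[v]opprK; apply: zmod_setB => //.
by rewrite -sub0r; apply: zmod_setB => //; apply: zmod_set0.
Qed.

Lemma zmod_setMn u n : P u -> P (u *+ n).
Proof.
move=> Pu; elim: n => [|n IHn]; first by rewrite mulr0n; apply: zmod_set0.
by rewrite mulrS; apply: zmod_setD.
Qed.

Lemma zmod_set_sum (I : Type) (r : seq I) (F : I -> V) :
  (forall i, P (F i)) -> P (\sum_(i <- r) F i).
Proof.
move=> PF; elim/big_rec: _ => [|i x _ Px]; first exact: zmod_set0.
exact: zmod_setD.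
Qed.

Lemma zmod_set_image (W : zmodType) (phi : {additive V -> W}) :
  zmod_closed (mem (phi @` P)).
Proof.
split; first by apply/mem_set; exists 0; rewrite ?raddf0//; apply: zmod_set0.
move=> u v /set_mem[x Px <-] /set_mem[y Py <-]; apply/mem_set. 
by exists (x - y); rewrite ?raddfB//; apply: zmod_setB.
Qed.

(** The fibers of an additive map onto [W] are translates of one another, so each holds the same
    share of the [k * #|W|] points. *)
Lemma card_fiber (W : finZmodType) (phi : {additive V -> W}) (k : nat) :
  P #= `I_(k * #|W|)%N -> (forall w, (phi @` P) w) ->
  forall w, (P `&` phi @^-1` [set w]) #= `I_k.
Proof.
move=> Pk phiP.
have [A PA] : exists A : {fset V}, P = [set` A].
  by apply/finite_fsetP; exists (k * #|W|)%N.
pose fiber w := [fset x in A | phi x == w]%fset.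
have fiberE w : P `&` phi @^-1` [set w] = [set` fiber w].
  apply/seteqP; split=> x; rewrite /= PA !inE /=.
    by case=> -> /eqP.
  by case/andP=> -> /eqP.
have fiber_le w w' : (#|` fiber w| <= #|` fiber w'|)%N.
  have [x Px xw] := phiP w; have [y Py yw'] := phiP w'.
  (* With [x] over [w] and [y] over [w'], translation by [y - x] embeds the first fiber in the
     second. *)
  apply: (@leq_trans #|` [fset (z + (y - x))%R | z in fiber w]%fset|).
    by rewrite (card_imfset _ _ (@addIr _ _)).
  apply/fsubset_leq_card/fsubsetP.
  move=> _ /imfsetP[z /= /[!inE]/= /andP[Az /eqP zw] ->].
  have Pz' : P z by rewrite PA.
  have : P (z + (y - x)) by apply: zmod_setD => //; apply: zmod_setB.
  rewrite PA /= => ->.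
  by rewrite raddfD raddfB /= zw xw yw' addrC subrK eqxx.
move=> w; rewrite fiberE; apply/card_eq_fsetP.
have Wgt0 : (0 < #|W|)%N by apply/card_gt0P; exists 0.
apply/eqP; rewrite -(eqn_pmul2r Wgt0); apply/eqP.
move: Pk; rewrite PA => /card_eq_fsetP <-.
rewrite mulnC -sum_nat_const [RHS]card_fset_sum1 (partition_big phi xpredT) //=.
apply: eq_bigr => w' _; rewrite big_fset_condE /= -card_fset_sum1.
by apply/eqP; rewrite eqn_leq !fiber_le.
Qed.

End Subgroups.

(** Every scalar of ['F_b] is a natural multiple of 1, so an additive subgroup is a linear subspace,
    and a proper subspace is killed by a nonzero linear form. *)
Lemma zmod_set_annihilator (b n : nat) (S : set 'rV['F_b]_n) :
  zmod_closed (mem S) ->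
  (forall v, S v) \/ exists2 v : 'cV_n, v != 0 & forall u, S u -> u *m v = 0.
Proof.
move=> Sz.
(* The rows of [M] list all the elements of [S]. If they do not span, a nonzero column of the
   cokernel of [M] is the form sought. *)
pose M : 'M_(#|mem S|, n) := \matrix_i enum_val i.
have [/row_fullP[N NM]|] := boolP (row_full M).
  left=> v; rewrite -[v]mulmx1 -NM mulmxA mulmx_sum_row.
  apply: zmod_set_sum => // i; rewrite rowK -[_ 0 i]natr_Zp scaler_nat.
  by apply: zmod_setMn => //; apply/set_mem/enum_valP.
rewrite -cokermx_eq0 => /matrix0Pn[i [j Mij]]; right.
exists (col j (cokermx M)).
  by apply: contraNneq Mij => /colP/(_ i) /[!mxE] ->.
move=> u /mem_set Su.
have -> : u = row (enum_rank_in Su u) M by rewrite rowK enum_rankK_in.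
by rewrite -row_mul colE mulmxA mulmx_coker mul0mx row0.
Qed.

(** * Coefficients, residues and degrees of Laurent series *)

Section Laurent.
Variable F : fieldType.
Implicit Types f g h : laurent F.

Lemma lcoef_lmonomM (a : F) i f j : (lmonom a i * f) j = a * f (j - i).
Proof.
rewrite -[LHS]/(lmul_coef (lmonom a i) f j) /lmul_coef.
rewrite -(fsbig_widen [set i]) // => [|k [_ /eqP/negPf ki]] /=.
  by rewrite fsbig_set1 eqxx.
by rewrite ki mul0r.
Qed.

Lemma lcoef_sum (I : Type) (r : seq I) (P : pred I) (G : I -> laurent F) j :
  (\sum_(i <- r | P i) G i) j = \sum_(i <- r | P i) G i j.
Proof. by apply: (big_morph (fun f : laurent F => f j)). Qed.

(** The term of degree [k] in [p] has index [-k], so it meets the coefficient of index [k + 1] of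
    [f]. Any bound [n] on the size will do, since the extra coefficients of [p] vanish. *)
Lemma res_poly_laurentM (p : {poly F}) f (n : nat) : (size p <= n)%N ->
  res (poly_laurent p * f) = \sum_(k < n) p`_k * f k.+1%:Z.
Proof.
move=> pn; rewrite /res /poly_laurent mulr_suml lcoef_sum.
rewrite (big_ord_widen n (fun k => (lmonom p`_k (- k%:Z) * f) 1)) // big_mkcond.
apply: eq_bigr => k _; case: ltnP => [_|kp].
  by rewrite lcoef_lmonomM; congr (_ * f _); lia.
by rewrite nth_default ?mul0r.
Qed.

Lemma ldeg_lt f (z : int) : (ldeg f < (- z)%:E)%E <-> vanishes_below (z + 1) f.
Proof.
have [->|f0] := eqVneq f 0.
  by rewrite /ldeg eqxx ltNyr; split=> // _ i _; rewrite lcoef0.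
have [w fw] := laurent_lb f.
(* Counting from a lower bound [w] makes the indices natural numbers, so that a least nonzero
   coefficient exists; it determines the degree. *)
have exn : exists n : nat, f (w + n%:Z) != 0.
  apply/not_existsP => nf; case/eqP: f0; apply: (laurent_shift_eq fw) => // n.
  by rewrite lcoef0; apply/eqP/negPn/negP/nf.
case: (ex_minnP exn) => n fn nmin.
have fwn : vanishes_below (w + n%:Z) f.
  move=> i iwn; have [/fw//|wi] := ltP i w.
  apply/eqP; apply: contraTT iwn => fi.
  have := nmin (`|i - w|)%N; rewrite gez0_abs ?subr_ge0//.
  rewrite (_ : w + (i - w) = i); last by lia.
  by move=> /(_ fi); lia.
rewrite (ldegE fn fwn) lte_fin; split=> [zwn i iz|fz].
  by apply: fwn; lia.
by rewrite ltNge; apply: contra fn => le; rewrite fz//; lia.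
Qed.

Lemma digit_series_lcoef (c : nat -> F) (l : nat) (i : int) :
  (\sum_(1 <= k < l.+1) lmonom (c k) k%:Z) i =
  if 0 < i <= l%:Z then c `|i|%N else 0.
Proof.
rewrite lcoef_sum /=; case: ifP => il.
  rewrite (bigD1_seq `|i|%N) ?iota_uniq ?mem_index_iota //=; last by lia.
  rewrite ifT; last by apply/eqP; lia.
  by rewrite big1 ?addr0// => k ki; rewrite ifF//; apply/eqP; lia.
rewrite big_nat_cond big1// => k; rewrite andbT => kl; rewrite ifF//.
by apply/eqP => ik; move: il; rewrite ik; lia.
Qed.

End Laurent.

(** * The digit map and its pairing with polynomial vectors *)

Section Digits.
Variables (F : fieldType) (d : nat) (l : 'I_d -> nat).

(** The blocks have different lengths [l j]; a single block row lets linear algebra treat them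
    together. Ordinals start at 0 and digits at index 1, hence [k.+1]. *)
Definition digits (h : 'rV[laurent F]_d) : 'rV[F]_(\sum_j l j) :=
  \mxrow_j \row_(k < l j) h 0 j k.+1%:Z.

Fact digits_is_zmod_morphism : zmod_morphism digits.
Proof.
move=> g h; rewrite -mxrowB; apply: eq_mxrow => j.
by apply/rowP=> k; rewrite !mxE.
Qed.

HB.instance Definition _ :=
  GRing.isZmodMorphism.Build 'rV[laurent F]_d _ digits digits_is_zmod_morphism.

Lemma digits_eqP g h : digits g = digits h <->
  forall j (k : 'I_(l j)), g 0 j k.+1%:Z = h 0 j k.+1%:Z.
Proof.
rewrite -eq_mxrowP; split=> gh j; last first.
  by apply/rowP => k; rewrite !mxE.
by move=> k; have /rowP/(_ k) := gh j; rewrite !mxE.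
Qed.

Lemma dual_pairingE (g : 'rV[{poly F}]_d) (h : 'rV[laurent F]_d) :
  (forall j, size (g 0%R j) <= l j)%N ->
  res (\sum_j poly_laurent (g 0 j) * h 0 j) =
  (digits h *m \mxcol_j (poly_rV (g 0 j))^T) 0 0.
Proof.
move=> gl; rewrite mul_mxrow_mxcol summxE /res lcoef_sum.
apply: eq_bigr => j _; rewrite -/(res _) (res_poly_laurentM _ (gl j)) mxE.
by apply: eq_bigr => k _; rewrite !mxE mulrC.
Qed.

End Digits.

(** * Nets, elementary boxes and the minimal weight *)

Section Nets.
Variables (b d : nat) (P : set 'rV[laurent 'F_b]_d).
Hypotheses (Pcube : P `<=` @unit_cube b d) (Pz : is_subgroup P).

Lemma digits_onto (l : 'I_d -> nat) :
  (forall v, (digits l @` P) v) <->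
  (forall g, dual_space P g -> (forall j, size (g 0%R j) <= l j)%N -> g = 0).
Proof.
split=> [onto g gP gl|dual0].
  pose v := \mxcol_j (poly_rV (g 0 j) : 'rV_(l j))^T.
  have v0 : v = 0.
    (* Row [i] of [v] is its product with the [i]-th unit row, which is the digit vector of some
       point of [P]. *)
    apply/row_matrixP => i; rewrite row0 -[v]mul1mx row_mul.
    have [h Ph <-] := onto (row i 1%:M).
    by apply/matrixP => k k'; rewrite !ord1 -dual_pairingE // gP // mxE.
  apply/rowP => j; rewrite mxE -(poly_rV_K (gl j)).
  have := congr1 (fun A => (submxcol A j)^T) v0.
  by rewrite mxcolK trmxK => ->; rewrite submxcol0 trmx0 linear0.
have [//|[v v0 vP]] := zmod_set_annihilator (zmod_set_image Pz (digits l)).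
(* The blocks of the annihilating vector become the coefficients of polynomials. *)
pose g := \row_j rVpoly (submxcol v j)^T.
have gl j : (size (g 0%R j) <= l j)%N by rewrite mxE size_poly.
have gE : \mxcol_j (poly_rV (g 0 j) : 'rV_(l j))^T = v.
  by rewrite -[RHS]submxcolK; apply: eq_mxcol => j; rewrite mxE rVpolyK trmxK.
have g0 : g = 0.
  apply: dual0 => // h Ph.
  by rewrite (dual_pairingE _ gl) gE vP ?mxE//; exists h.
case/eqP: v0; rewrite -gE; apply/mxcolP => j.
by rewrite mxcolK g0 mxE linear0 trmx0 submxcol0.
Qed.

Lemma unit_cubeP (g : 'rV[laurent 'F_b]_d) :
  unit_cube g <-> forall j, vanishes_below 1 (g 0 j).
Proof. by split=> gP j; apply/(ldeg_lt _ 0)/gP. Qed.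

Lemma elementary_box_digits (l : 'I_d -> nat) (h : 'rV[laurent 'F_b]_d) :
  (forall j, digit_series (l j) (h 0 j)) ->
  elementary_box l h `&` P = P `&` digits l @^-1` [set digits l h].
Proof.
move=> hl; apply/seteqP; split=> g /= [].
  case=> _ gh Pg; split=> //; apply/digits_eqP => j k.
  have /ldeg_lt/(_ k.+1%:Z) := gh j.
  rewrite lcoefB => /(_ _)/eqP; rewrite subr_eq0 => e; apply/eqP/e.
  by have := ltn_ord k; lia.
move=> Pg /digits_eqP gh; split=> //; split; first exact: Pcube.
move=> j; apply/ldeg_lt => i il; rewrite lcoefB.
have /unit_cubeP/(_ j) g1 := Pcube Pg.
have [c hE] := hl j.
(* The digits do not see the indices below 1; there [g] vanishes by membership in the cube and [h]
   by its shape. *)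
have [i1|i1] := ltP i 1.
  by rewrite g1 // hE digit_series_lcoef ifF ?subr0//; lia.
have ik : (`|i|.-1 < l j)%N by lia.
have := gh j (Ordinal ik); rewrite /= (_ : (`|i|.-1.+1)%:Z = i); last by lia.
by move=> ->; rewrite subrr.
Qed.

Lemma digit_series_onto (l : 'I_d -> nat) (v : 'rV['F_b]_(\sum_j l j)) :
  exists2 h : 'rV[laurent 'F_b]_d,
    (forall j, digit_series (l j) (h 0 j)) & digits l h = v.
Proof.
pose c j i := (rVpoly (submxrow v j))`_(i.-1).
exists (\row_j \sum_(1 <= i < (l j).+1) lmonom (c j i) i%:Z).
  by move=> j; exists (c j); rewrite mxE.
rewrite -[RHS]submxrowK; apply: eq_mxrow => j; apply/rowP => k.
rewrite !mxE digit_series_lcoef ifT; last by have := ltn_ord k; lia.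
by rewrite /c /= coef_rVpoly_ord mxE.
Qed.

(** A net meets every box because [b ^ t] is positive. Conversely, equal fibers of [b ^ m] points
    over [b ^ (m - t)] vectors have [b ^ t] points each. *)
Lemma is_netE (t m : nat) : prime b -> (t <= m)%N -> P #= `I_(b ^ m) ->
  is_net t m P <->
  forall l : 'I_d -> nat, (\sum_j l j)%N = (m - t)%N ->
    forall v, (digits l @` P) v.
Proof.
move=> b_prime tm Pm; split=> [[_ _ net] l lmt v|onto].
  have [h hl hv] := digit_series_onto v.
  have := net l h lmt hl; rewrite elementary_box_digits // hv => fib.
  have [fib0|] := eqVneq (P `&` digits l @^-1` [set v]) set0; last first.
    by move/set0P => [g [Pg gv]]; exists g.
  move: fib; rewrite fib0 card_eq_sym card_eq0 => /eqP I0.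
  by suff : `I_(b ^ t) 0%N; [rewrite I0 | rewrite /= expn_gt0 prime_gt0].
split=> // l h lmt hl; rewrite elementary_box_digits //.
apply: card_fiber => //; last exact: onto.
by rewrite card_mx card_Fp // mul1n lmt -expnD subnKC.
Qed.

(** Weights are natural numbers, so the infimum is attained, unless the dual space is trivial: then
    it is [+oo] and both sides hold. *)
Lemma le_minNRT (n : nat) :
  (n%:Z%:E <= minNRT P)%E <->
  (forall g, dual_space P g -> g != 0 -> (n <= NRT_weight g)%N).
Proof.
rewrite /minNRT; set A := [set _ | _ in _].
have [[g [gP gn0]]|noexg] := EM (exists g, dual_space P g /\ g != 0); last first.
  have g0 g : dual_space P g -> g = 0.
    by move=> gP; apply/eqP/negPn/negP => gn0; apply: noexg; exists g.
  have -> : A = set0.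
    by apply/seteqP; split=> // x [g [gP gn0] _]; case: gn0; apply: g0.
  rewrite /infimum eqxx leey; split=> // _ g /g0 ->.
  by rewrite eqxx.
pose isweight k :=
  `[< exists g, [/\ dual_space P g, g != 0 & NRT_weight g = k] >].
have exw : exists k, isweight k.
  by exists (NRT_weight g); apply/asboolP; exists g.
case: (ex_minnP exw) => w /asboolP[g0 [g0P g0n0 g0w]] wmin.
have Aw : A w%:Z%:E by exists g0; rewrite ?g0w//; split=> //; apply/eqP.
have infw : infimums A w%:Z%:E.
  split; last by move=> x; apply.
  move=> _ [h [hP hn0] <-]; rewrite lee_fin; have := wmin (NRT_weight h).
  by rewrite lez_nat; apply; apply/asboolP; exists h; split=> //; apply/eqP.
rewrite /infimum ifF; last by apply/negbTE/set0P; exists w%:Z%:E.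
rewrite (xget_subset1 _ infw) ?lee_fin ?lez_nat; last exact: is_subset1_infimums.
split=> [nw h hP hn0|]; last by rewrite -g0w; apply.
by apply: (leq_trans nw); apply: wmin; apply/asboolP; exists h.
Qed.

End Nets.

Unset Implicit Arguments.
Set Strict Implicit.

Theorem theorem6p4 (b d m t : nat) (P : set 'rV[laurent 'F_b]_d) :
  prime b -> (1 <= d)%N -> (1 <= m)%N -> (t <= m)%N ->
  P `<=` @unit_cube b d -> is_subgroup P -> P #= `I_(b ^ m) ->
  is_net t m P <-> ((m - t + 1)%N%:Z%:E <= minNRT P)%E.
Proof.
move=> b_prime d_gt0 _ tm Pcube Pz Pm.
rewrite le_minNRT (is_netE Pcube Pz b_prime tm Pm).
(* For the converse, the bounds [size (g 0 j) <= l j] add up to a weight of at most [m - t], which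
   only [g = 0] can have. *)
split=> [onto g gP gn0|wt l lmt]; last first.
  apply/(digits_onto Pz) => g gP gl; apply/eqP/negPn/negP => gn0.
  have := wt g gP gn0; rewrite addn1 -lmt ltnNge; case/negP.
  by apply: leq_sum => j _.
rewrite addn1 ltnNge; apply/negP => small.
pose j0 := Ordinal d_gt0.
(* The shape must sum to exactly [m - t]: the sizes of [g] may fall short, and coordinate [j0] takes
   up the deficit. *)
pose l (j : 'I_d) := (size (g 0%R j) + (j == j0) * (m - t - NRT_weight g))%N.
suff lmt : (\sum_j l j)%N = (m - t)%N.
  have /(digits_onto Pz)/(_ g gP) g0 := onto l lmt.
  by case/eqP: gn0; apply: g0 => j; apply: leq_addr.
rewrite big_split /= -/(NRT_weight g) [X in (_ + X)%N](bigD1 j0) //= mul1n.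
by rewrite big1 ?addn0 ?subnKC// => j /negPf ->.
Qed.
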